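(* Let $\mathsf{P}_{\ast}\subset\mathbb{R}^{2}$ be a (closed, filled) ellipse that is not a disk, with centre of mass at the origin, and let $S$ be the classical Boltzmann scattering. Then there exist an initial spatial configuration $X_{0}=[x_{0},\overline{x}_{0},\vartheta_{0},\overline{\vartheta}_{0}]\in\partial\mathcal{P}_{2}(\mathsf{P}_{\ast})$, an initial velocity vector $V_{0}=[v_{0},\overline{v}_{0},\omega_{0},\overline{\omega}_{0}]\in\Sigma^{0}_{X_{0}}=\{V\in\mathbb{R}^{6}: S(X_{0},V)=V\}$, and $\delta=\delta(X_{0})>0$ such that $$\mathscr{L}_{2}(\mathsf{P}(t)\cap\overline{\mathsf{P}}(t))>0\quad\text{for all } -\delta<t<0\ \text{ and all }\ 0<t<\delta,$$ where, for $-\delta<t<\delta$, $$\mathsf{P}(t)=R(\vartheta_{0}+t\omega_{0})\mathsf{P}_{\ast}+x_{0}+tv_{0},\qquad \overline{\mathsf{P}}(t)=R(\overline{\vartheta}_{0}+t\overline{\omega}_{0})\mathsf{P}_{\ast}+\overline{x}_{0}+t\overline{v}_{0}.$$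
   Context: $\mathscr{L}_{2}$ is Lebesgue measure on $\mathbb{R}^{2}$; $R(\theta)\in\mathrm{SO}(2)$ is rotation by the angle $\theta$; $y^{\perp}:=(-y_{2},y_{1})$ for $y\in\mathbb{R}^2$. Configurations are $X=[x,\overline{x},\vartheta,\overline{\vartheta}]$ with $x,\overline{x}\in\mathbb{R}^{2}$ and $\vartheta,\overline{\vartheta}$ angles. The set of collision configurations $\partial\mathcal{P}_{2}(\mathsf{P}_{\ast})$ consists of those $X$ for which $(R(\vartheta)\mathsf{P}_{\ast}+x)\cap(R(\overline{\vartheta})\mathsf{P}_{\ast}+\overline{x})$ is non-empty and has $\mathscr{L}_{2}$-measure zero. For an ellipse $\mathsf{P}_{\ast}$ and $X\in\partial\mathcal{P}_{2}(\mathsf{P}_{\ast})$, this intersection is a single point $c_{X}$. Put $p_{X}:=c_{X}-x$, $q_{X}:=c_{X}-\overline{x}$, and let $n_{X}$ be the outward unit normal to $R(\vartheta)\mathsf{P}_{\ast}+x$ at $c_{X}$. Let $m:=\int_{\mathsf{P}_{\ast}}dy$, $J:=\int_{\mathsf{P}_{\ast}}|y|^{2}dy$, $M:=\mathrm{diag}(\sqrt m,\sqrt m,\sqrt m,\sqrt m,\sqrt J,\sqrt J)$, $$\nu_{X}:=\left[-n_{X},\ n_{X},\ -p_{X}^{\perp}\cdot n_{X},\ q_{X}^{\perp}\cdot n_{X}\right]\in\mathbb{R}^{6},\qquad \widehat{\nu}_{X}:=\frac{M^{-1}\nu_{X}}{|M^{-1}\nu_{X}|}.$$ The classical Boltzmann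 scattering $S:\partial\mathcal{P}_{2}(\mathsf{P}_{\ast})\times\mathbb{R}^{6}\to\mathbb{R}^{6}$ is $S(X,V):=M^{-1}(I-2\,\widehat{\nu}_{X}\otimes\widehat{\nu}_{X})MV$. *)

(* Defs.v *)
From HB Require Import structures.
From mathcomp Require Import all_boot all_order all_algebra.
From mathcomp Require Import all_classical all_reals all_analysis.

Set Implicit Arguments.
Unset Strict Implicit.
Unset Printing Implicit Defensive.

Import Order.TTheory GRing.Theory Num.Theory.
Import numFieldNormedType.Exports.

Local Open Scope classical_set_scope.
Local Open Scope ring_scope.

Section Plane.
Variable R : realType.
Implicit Types (x y n c : R * R) (K P : set (R * R)).

Definition leb2 : set (R * R) -> \bar R :=
  (@lebesgue_measure R \x @lebesgue_measure R)%E.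

(* The norm `|y| of the library on R * R is the sup norm, so the Euclidean
   structure is introduced here. *)
Definition dot2 x y : R := x.1 * y.1 + x.2 * y.2.
Definition norm2 y : R := Num.sqrt (dot2 y y).
Definition perp y : R * R := (- y.2, y.1).

Definition rot (theta : R) y : R * R :=
  (cos theta * y.1 - sin theta * y.2, sin theta * y.1 + cos theta * y.2).

Definition placed (theta : R) x P : set (R * R) :=
  [set rot theta y + x | y in P].

Definition is_ellipse P : Prop :=
  exists (c : R * R) (alpha a b : R), [/\ 0 < a, 0 < b &
    P = placed alpha c [set y | (y.1 / a) ^+ 2 + (y.2 / b) ^+ 2 <= 1]].

Definition is_disk P : Prop :=
  exists (c : R * R) (r : R), 0 < r /\ P = [set y | norm2 (y - c) <= r].

Definition integral2 P (f : R * R -> R) : R :=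
  Rintegral (@lebesgue_measure R \x @lebesgue_measure R)%E P f.

Definition mass P : R := integral2 P (fun=> 1).

Definition inertia P : R := integral2 P (fun y => norm2 y ^+ 2).

Definition centre_of_mass P : R * R :=
  ((mass P)^-1 * integral2 P fst, (mass P)^-1 * integral2 P snd).

Definition grad (f : R * R -> R) y : R * R :=
  ('D_((1, 0) : R * R) f y, 'D_((0, 1) : R * R) f y).

(* K is, near c, the sublevel set {f <= 0} of a C^1 function f which vanishes
   at c with non-zero gradient, and n is the normalised gradient of f at c. *)
Definition outward_unit_normal K c n : Prop :=
  exists f : R * R -> R,
    [/\ \forall y \near c, differentiable f y /\ {for y, continuous (grad f)},
        \forall y \near c, K y <-> f y <= 0,
        f c = 0,
        grad f c != 0
      & n = (norm2 (grad f c))^-1 *: grad f c].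

(* Angles are represented by real numbers. *)
Record config := Config {
  pos : R * R;
  posbar : R * R;
  ang : R;
  angbar : R }.

Definition body P (X : config) : set (R * R) := placed (ang X) (pos X) P.
Definition bodybar P (X : config) : set (R * R) :=
  placed (angbar X) (posbar X) P.

Definition collision_configs P : set config :=
  [set X | body P X `&` bodybar P X !=set0 /\
           leb2 (body P X `&` bodybar P X) = 0%E].

(* For an ellipse and a collision configuration, the two sets from which
   [contact] and [normal] are extracted are singletons; the default value 0 is
   only used elsewhere. *)
Definition contact P (X : config) : R * R :=
  xget 0 (body P X `&` bodybar P X).

Definition normal P (X : config) : R * R :=
  xget 0 [set n | outward_unit_normal (body P X) (contact P X) n].

Definition vec6 (v vbar : R * R) (om ombar : R) : 'cV[R]_6 :=
  \col_(i < 6) [:: v.1; v.2; vbar.1; vbar.2; om; ombar]`_i.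

Definition norm6 (V : 'cV[R]_6) : R := Num.sqrt (\sum_i V i 0 ^+ 2).

Definition mass_matrix P : 'M[R]_6 :=
  let sm := Num.sqrt (mass P) in let sJ := Num.sqrt (inertia P) in
  diag_mx (\row_(i < 6) [:: sm; sm; sm; sm; sJ; sJ]`_i).

Definition nu P (X : config) : 'cV[R]_6 :=
  let p := contact P X - pos X in
  let q := contact P X - posbar X in
  let n := normal P X in
  vec6 (- n) n (- dot2 (perp p) n) (dot2 (perp q) n).

Definition nuhat P (X : config) : 'cV[R]_6 :=
  let w := invmx (mass_matrix P) *m nu P X in (norm6 w)^-1 *: w.

Definition scattering P (X : config) (V : 'cV[R]_6) : 'cV[R]_6 :=
  invmx (mass_matrix P) *m
    (1%:M - 2 *: (nuhat P X *m (nuhat P X)^T)) *m mass_matrix P *m V.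

Definition Sigma0 P (X : config) : set 'cV[R]_6 :=
  [set V | scattering P X V = V].

End Plane.

(* Main.v *)
Require Import Defs.
From mathcomp Require Import all_boot all_order all_algebra.
From mathcomp Require Import all_classical all_reals all_analysis.
From mathcomp Require Import measurable_realfun.
From mathcomp Require Import ring lra.

Import Order.TTheory GRing.Theory Num.Theory.
Import numFieldNormedType.Exports.

Local Open Scope classical_set_scope.
Local Open Scope ring_scope.

(** Take the two bodies with their short axes on a common vertical line and let
    them touch at the origin, each at an end of its short axis (semi-axis
    [b < a]): the centres are [(0, - b)] and [(0, b)]. Keep both centres at rest
    and spin the bodies in opposite directions with angular speed 1, like two
    gears.

    The first body lies in the lower half-plane and the second in the upper one,
    and they meet only at the origin, so this is a collision configuration. The
    material points in contact have the same velocity, so the relative normal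
    velocity is zero whatever the normal is ([nu_contact_velocity]), and such a
    velocity vector is fixed by the scattering ([scattering_grazing]).

    At time [t] the squared ratio of the distance [b] to the radius of each body
    in the direction of the origin is [cos t ^ 2 + (b / a) ^ 2 * sin t ^ 2].
    When [sin t] is not zero this is less than 1: the short axis is the only
    direction in which the radius is as small as [b]. So the origin is interior
    to both bodies, and their intersection has positive measure.

    The bodies rotate about the origin of the reference ellipse, which must
    therefore be its centre. The point reflection through the centre preserves
    the ellipse and Lebesgue measure, so the centre is the centre of mass
    ([ellipse_centre_of_mass]). *)

(** * Lebesgue measure of the plane *)

Section PlaneMeasure.
Context {R : realType}.
Implicit Types (P : set (R * R)) (f : R * R -> R) (c y z : R * R).

Local Notation mu := (@lebesgue_measure R).
Local Notation mu2 := (mu \x mu)%E.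
Local Notation plane := (measurableTypeR R * measurableTypeR R)%type.

Lemma leb2_setX (A B : set R) : measurable A -> measurable B ->
  leb2 (A `*` B) = (mu A * mu B)%E.
Proof. by move=> mA mB; exact: product_measure1E. Qed.

Lemma leb2_ball z (r : R) : 0 <= r ->
  leb2 (ball z r) = ((r *+ 2) * (r *+ 2))%:E.
Proof.
move=> r0; rewrite (_ : ball z r = ball z.1 r `*` ball z.2 r)//.
by rewrite leb2_setX ?lebesgue_measure_ball//; exact: measurable_ball.
Qed.

Lemma measurable_ball2 z (r : R) : measurable (ball z r : set (R * R)).
Proof.
rewrite (_ : ball z r = ball z.1 r `*` ball z.2 r)//.
by apply: measurableX; exact: measurable_ball.
Qed.

Lemma leb2_nbhs_gt0 P z : measurable P -> nbhs z P -> (0 < leb2 P)%E.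
Proof.
move=> mP /nbhs_ballP[r /= r0 rP]; apply: (@lt_le_trans _ _ (leb2 (ball z r))).
  by rewrite leb2_ball ?ltW// lte_fin mulr_gt0// mulrn_wgt0.
by apply: le_measure => //; rewrite inE//; exact: measurable_ball2.
Qed.

Lemma leb2_set1 z : leb2 [set z] = 0%E.
Proof.
rewrite (_ : [set z] = [set z.1] `*` [set z.2]); last first.
  apply/seteqP; split => [_ ->//|[u v] /= [-> ->]].
  by rewrite -surjective_pairing.
by rewrite leb2_setX// !lebesgue_measure_set1 mule0.
Qed.

Lemma leb2_bounded_lty P (B : R) : measurable P ->
  (forall y, P y -> `|y| <= B) -> (leb2 P < +oo)%E.
Proof.
move=> mP PB; apply: (@le_lt_trans _ _ (leb2 (ball 0 (`|B| + 1)))).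
  apply: le_measure => //; rewrite ?inE//; first exact: measurable_ball2.
  move=> y /PB yB; rewrite -ball_normE /ball_/= sub0r normrN.
  by rewrite ltr_pwDr// (le_trans yB)// ler_norm.
by rewrite leb2_ball ?ltry// addr_ge0.
Qed.

(** Near [z] the function stays above [f z / 2] on a ball of positive measure;
    the bounds on [f] and on the measure of [P] keep the integral finite, as an
    infinite one would have the real value 0. *)
Lemma integral2_gt0 P f (C : R) z :
    measurable P -> (leb2 P < +oo)%E -> nbhs z P ->
    measurable_fun setT f -> {for z, continuous f} ->
    (forall y, P y -> 0 <= f y <= C) -> 0 < f z ->
  0 < integral2 P f.
Proof.
move=> mP Pfin zP mf fz f0C fz0.
have mfP : measurable_fun P (EFin \o f).
  by apply/measurable_EFinP; exact: measurable_funTS.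
have f0 y : P y -> (0 <= (f y)%:E)%E.
  by move=> Py; rewrite lee_fin; case/andP: (f0C _ Py).
rewrite /integral2 /Rintegral fine_gt0//; apply/andP; split; last first.
  apply: (@le_lt_trans _ _ (\int[mu2]_(y in P) (cst C%:E y))%E).
    apply: ge0_le_integral => //.
    by move=> y Py; rewrite lee_fin; case/andP: (f0C _ Py).
  have C0 : 0 <= C.
    by case/andP: (f0C _ (nbhs_singleton zP)) => /le_trans; apply.
  by rewrite integral_cst// lte_mul_pinfty.
have /nbhs_ballP[r /= r0 rP] : nbhs z (P `&` [set y | f z / 2 < f y]).
  apply: filterI => //; apply: (cvgr_gt (f z) fz).
  by rewrite ltr_pdivrMr// ltr_pMr// ltr1n.
have mr := measurable_ball2 z r.
apply: (@lt_le_trans _ _ (\int[mu2]_(y in ball z r) (cst (f z / 2)%:E y))%E).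
  rewrite integral_cst//; apply: mule_gt0; first by rewrite lte_fin divr_gt0.
  by apply: (leb2_nbhs_gt0 _ z) => //; exact: nbhsx_ballx.
apply: (@le_trans _ _ (\int[mu2]_(y in ball z r) (f y)%:E)%E).
  apply: ge0_le_integral => //.
  - by move=> y _; rewrite lee_fin divr_ge0// ltW.
  - by apply: measurable_funS mfP => // y /rP[].
  - by move=> y /rP[_ /=]; rewrite lee_fin => /ltW.
by apply: ge0_subset_integral => // y /rP[].
Qed.

(** Together with the uniqueness of product measures, this makes point
    reflections of the plane measure-preserving. *)
Lemma lebesgue_measure_reflect (d : R) (A : set R) : measurable A ->
  pushforward mu (fun x : measurableTypeR R => d - x : measurableTypeR R) A =
    mu A.
Proof.
move=> mA; apply/esym/lebesgue_measure_unique => //=.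
  exact: measurable_funB.
move=> _ _ [[a b]] _ <-.
rewrite /pushforward (_ : _ @^-1` _ = `[d - b, d - a[%classic); last first.
  by apply/seteqP; split => x /=; rewrite !in_itv/=; lra.
rewrite !lebesgue_measure_itv/= !lte_fin -!EFinD.
by rewrite ltrD2l ltrN2; case: ifP => // _; congr EFin; ring.
Qed.

Definition point_reflect c y : R * R := (c.1 *+ 2 - y.1, c.2 *+ 2 - y.2).

Lemma measurable_point_reflect c :
  measurable_fun setT (point_reflect c : plane -> plane).
Proof. by apply/measurable_fun_pairP; split; apply: measurable_funB. Qed.

Lemma leb2_point_reflect c (A : set (R * R)) : measurable A ->
  pushforward mu2 (point_reflect c : plane -> plane) A = leb2 A.
Proof.
move=> mA; rewrite /leb2; apply/esym.
apply: (@product_measure_unique _ _ _ _ R mu mu _ _ A mA).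
  exact: measurable_point_reflect.
move=> ? X Y mX mY; rewrite /= /pushforward.
rewrite (_ : _ @^-1` _ = (fun x => c.1 *+ 2 - x) @^-1` X `*`
  (fun x => c.2 *+ 2 - x) @^-1` Y)//.
have mrefl (d : R) (B : set R) : measurable B ->
    measurable ((fun x : R => d - x) @^-1` B).
  move=> mB; rewrite -[X in measurable X]setTI.
  by apply: (measurable_funB (f := cst d) (g := id)) mB => //.
rewrite -[LHS]/(leb2 _) leb2_setX//; [|exact: mrefl..].
congr (_ * _)%E.
  exact: (lebesgue_measure_reflect (c.1 *+ 2)).
exact: (lebesgue_measure_reflect (c.2 *+ 2)).
Qed.

Lemma reflect_integral2 P f c : measurable P -> measurable_fun setT f ->
  mu2.-integrable P (EFin \o (f \o point_reflect c)) ->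
  point_reflect c @^-1` P = P ->
  integral2 P (f \o point_reflect c) = integral2 P f.
Proof.
move=> mP mf intf cP; rewrite /integral2 /Rintegral; congr fine.
have H := @integral_pushforward _ _ plane plane R (point_reflect c)
  (measurable_point_reflect c) mu2 P (EFin \o f).
rewrite cP in H; rewrite -H; last 3 first.
- exact/measurable_EFinP.
- exact: intf.
- exact: mP.
apply: eq_measure_integral; first exact: measurable_point_reflect.
by move=> ? A mA _; exact: leb2_point_reflect.
Qed.

(** The reflection through [c] turns each coordinate [y_i] into [2 c_i - y_i]
    and preserves its integral over [P], which is therefore [c_i] times the
    mass. *)
Lemma centre_of_mass_reflect P c (B : R) :
    measurable P -> (forall y, P y -> `|y| <= B) -> mass P != 0 ->
    point_reflect c @^-1` P = P ->
  centre_of_mass P = c.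
Proof.
move=> mP PB massP cP.
have Pfin := leb2_bounded_lty _ _ mP PB.
have coord (g : R * R -> R) (d : R) : measurable_fun setT g ->
    (forall y, `|g y| <= `|y|) ->
    (forall y, g (point_reflect c y) = d *+ 2 - g y) ->
    integral2 P g = d * mass P.
  move=> mg gB gE.
  have ig : mu2.-integrable P (EFin \o g).
    apply: measurable_bounded_integrable => //; first exact: measurable_funTS.
    by exists B; split => [|M BM y Py]; rewrite ?num_real//=
      (le_trans (gB y))// (le_trans (PB _ Py))// ltW.
  have i1 : mu2.-integrable P (EFin \o cst (d *+ 2)).
    apply: measurable_bounded_integrable => //.
    by exists `|d *+ 2|; split => [|M BM y Py]; rewrite ?num_real//= ltW.
  have E : integral2 P (g \o point_reflect c) = d *+ 2 * mass P - integral2 P g.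
    rewrite /integral2 (_ : g \o _ = fun y => d *+ 2 - g y); last first.
      by apply/funext => y /=; rewrite gE.
    by rewrite RintegralB// /mass /integral2 !Rintegral_cst// mul1r.
  have := E; rewrite reflect_integral2//; first by lra.
  rewrite (_ : _ \o _ = (fun y => (d *+ 2)%:E - (g y)%:E)%E).
    exact: integrableB.
  by apply/funext => y /=; rewrite gE.
have le_fst y : `|y.1| <= `|y| by rewrite prod_normE le_max lexx.
have le_snd y : `|y.2| <= `|y| by rewrite prod_normE le_max lexx orbT.
rewrite /centre_of_mass (coord fst c.1)// (coord snd c.2)//.
by rewrite mulrCA mulVf// mulr1 mulrCA mulVf// mulr1 -surjective_pairing.
Qed.

End PlaneMeasure.

(** * Ellipses *)

Section Ellipse.
Context {R : realType}.
Implicit Types (P : set (R * R)) (d x y z : R * R) (a b s t : R).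

(** The quadratic form whose unit ball is the ellipse with semi-axes [a] and
    [b], turned by the angle [t]; the two parentheses are the coordinates of [d]
    in the turned frame. *)
Definition ellQ a b t d : R :=
  ((cos t * d.1 + sin t * d.2) / a) ^+ 2 +
  ((cos t * d.2 - sin t * d.1) / b) ^+ 2.

(** The filled ellipse with centre [c], with semi-axis [a] in the direction of
    angle [t] and semi-axis [b] in the perpendicular one. *)
Definition ellipse a b t c : set (R * R) := [set z | ellQ a b t (z - c) <= 1].

Lemma ellQ_rot a b s t y : ellQ a b (s + t) (Defs.rot t y) = ellQ a b s y.
Proof.
have H := cos2Dsin2 t.
rewrite /ellQ /Defs.rot /= cosD sinD.
have -> : (cos s * cos t - sin s * sin t) * (cos t * y.1 - sin t * y.2) +
   (sin s * cos t + cos s * sin t) * (sin t * y.1 + cos t * y.2) =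
   (cos t ^+ 2 + sin t ^+ 2) * (cos s * y.1 + sin s * y.2) by ring.
have -> : (cos s * cos t - sin s * sin t) * (sin t * y.1 + cos t * y.2) -
   (sin s * cos t + cos s * sin t) * (cos t * y.1 - sin t * y.2) =
   (cos t ^+ 2 + sin t ^+ 2) * (cos s * y.2 - sin s * y.1) by ring.
by rewrite H !mul1r.
Qed.

Lemma rotNK t y : Defs.rot t (Defs.rot (- t) y) = y.
Proof.
have H := cos2Dsin2 t.
rewrite /Defs.rot /= cosN sinN [RHS]surjective_pairing -[y.1 in RHS]mul1r.
by rewrite -[y.2 in RHS]mul1r -H; congr pair; ring.
Qed.

Lemma placed_ellipse a b s t x :
  placed t x (ellipse a b s 0) = ellipse a b (s + t) x.
Proof.
rewrite /ellipse; apply/seteqP; split => [_ [y yE <-]|z zE] /=.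
  by rewrite addrK ellQ_rot -[y]subr0.
exists (Defs.rot (- t) (z - x)); last by rewrite rotNK subrK.
by rewrite /= subr0 -(ellQ_rot _ _ s t) rotNK.
Qed.

Lemma ellQ0 a b y : ellQ a b 0 y = (y.1 / a) ^+ 2 + (y.2 / b) ^+ 2.
Proof. by rewrite /ellQ cos0 sin0 !mul1r !mul0r addr0 subr0. Qed.

Lemma ellQ_pihalf a b t d : ellQ b a (t + pi / 2) d = ellQ a b t d.
Proof.
rewrite /ellQ cosDpihalf sinDpihalf addrC; congr (_ + _).
  by rewrite -sqrrN -mulNr; congr ((_ / _) ^+ 2); ring.
by congr ((_ / _) ^+ 2); ring.
Qed.

Lemma ellQ_circle a t d : ellQ a a t d = dot2 d d / a ^+ 2.
Proof.
rewrite /ellQ /dot2 -[d.1 * d.1 + _]mul1r -(cos2Dsin2 t) !expr_div_n -mulrDl.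
by congr (_ / _); ring.
Qed.

(** Turning by a right angle exchanges the semi-axes, so the longer one can be
    taken first; equal semi-axes would give a disk. *)
Lemma noncircular_ellipseP P : is_ellipse P -> ~ is_disk P ->
  exists c t a b, [/\ 0 < b, b < a & P = ellipse a b t c].
Proof.
move=> [c [t [a [b [a0 b0 PE]]]]] ndisk.
have {}PE : P = ellipse a b t c.
  rewrite PE (_ : [set y | _] = ellipse a b 0 0).
    by rewrite placed_ellipse add0r.
  by apply/seteqP; split => y; rewrite /ellipse/= subr0 ellQ0.
have [ab|ba|eqab] := ltgtP a b.
- exists c, (t + pi / 2), b, a; split => //.
  by rewrite PE; apply/seteqP; split => y; rewrite /ellipse/= ellQ_pihalf.
- by exists c, t, a, b.
exfalso; apply: ndisk; exists c, b; split => //.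
rewrite PE eqab /ellipse; apply/seteqP; split => y /=; rewrite ellQ_circle /norm2.
  rewrite ler_pdivrMr ?exprn_gt0// mul1r => /ler_wsqrtr.
  by rewrite sqrtr_sqr gtr0_norm.
rewrite ler_pdivrMr ?exprn_gt0// mul1r -[X in _ -> X <= _]sqr_sqrtr;
  last by rewrite addr_ge0 ?sqr_ge0.
by move=> h; rewrite lerXn2r// nnegrE ?sqrtr_ge0// ltW.
Qed.

Lemma ellQ_continuous a b t x : continuous (fun z => ellQ a b t (z - x)).
Proof.
have c1 : continuous (fun z : R * R => z.1 - x.1).
  by move=> z; apply: cvgB; [exact: cvg_fst|exact: cvg_cst].
have c2 : continuous (fun z : R * R => z.2 - x.2).
  by move=> z; apply: cvgB; [exact: cvg_snd|exact: cvg_cst].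
have sq (f : R * R -> R) : continuous f -> continuous (fun z => f z ^+ 2).
  by move=> cf z; rewrite /continuous_at expr2; apply: cvgM; exact: cf.
move=> z; apply: cvgD; apply: sq => {}z; apply: cvgMl; [apply: cvgD|apply: cvgB];
  apply: cvgMr; by [exact: c1|exact: c2].
Qed.

Lemma measurable_ellQ a b t x :
  measurable_fun setT (fun z => ellQ a b t (z - x)).
Proof.
by apply: measurable_funD; apply: measurable_funX; apply: measurable_funM => //;
  [apply: measurable_funD|apply: measurable_funB]; apply: measurable_funM => //;
  apply: measurable_funB.
Qed.

(** The ellipse lies between the disks of radii [b] and [a]: replacing one
    semi-axis by the other turns the form into that of a disk. *)
Lemma ellQ_bounds a b t d : 0 < b -> b <= a ->
  dot2 d d / a ^+ 2 <= ellQ a b t d <= dot2 d d / b ^+ 2.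
Proof.
move=> b0 ba; have a0 : 0 < a by lra.
rewrite -!(ellQ_circle _ t) /ellQ !expr_div_n.
have le u : u ^+ 2 / a ^+ 2 <= u ^+ 2 / b ^+ 2.
  rewrite ler_wpM2l ?sqr_ge0// lef_pV2 ?posrE ?exprn_gt0//.
  by rewrite lerXn2r// nnegrE ltW.
by rewrite lerD2l le lerD2r le.
Qed.

Lemma measurable_ellipse a b t c : measurable (ellipse a b t c).
Proof.
have := measurable_ellQ a b t c measurableT `]-oo, 1]%classic (measurable_itv _).
by rewrite setTI; congr (measurable _).
Qed.

Lemma ellipse_nbhs a b t c z : ellQ a b t (z - c) < 1 ->
  nbhs z (ellipse a b t c).
Proof.
move=> zlt; have : \forall y \near z, ellQ a b t (y - c) < 1.
  exact: (cvgr_lt _ (ellQ_continuous a b t c z)).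
by apply: filterS => y /= /ltW.
Qed.

Lemma ellipse_dot2_le a b t d : 0 < b -> b <= a -> ellQ a b t d <= 1 ->
  dot2 d d <= a ^+ 2.
Proof.
move=> b0 ba dle; have a0 : 0 < a by exact: lt_le_trans ba.
have /andP[+ _] := ellQ_bounds _ _ t d b0 ba.
by move=> /le_trans/(_ dle); rewrite ler_pdivrMr ?exprn_gt0// mul1r.
Qed.

Lemma ellipse_bounded a b t c y : 0 < b -> b <= a ->
  ellipse a b t c y -> `|y| <= a + `|c|.
Proof.
rewrite /ellipse/= => b0 ba /(ellipse_dot2_le _ _ _ _ b0 ba) yle.
have a0 : 0 < a by exact: lt_le_trans ba.
rewrite -[in leLHS](subrK c y) (le_trans (ler_normD _ _))// lerD2r.
have sq_le (u : R) : u ^+ 2 <= a ^+ 2 -> `|u| <= a.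
  by rewrite -[u ^+ 2]real_normK ?num_real// ler_pXn2r// nnegrE ltW.
rewrite prod_normE ge_max; apply/andP; split; apply: sq_le.
  by rewrite (le_trans _ yle)// /dot2 -!expr2 lerDl sqr_ge0.
by rewrite (le_trans _ yle)// /dot2 -!expr2 lerDr sqr_ge0.
Qed.

Lemma ellQ_at0 a b t : ellQ a b t 0 = 0.
Proof. by rewrite /ellQ !mulr0 addr0 subr0 !mul0r expr0n addr0. Qed.

Lemma ellQN a b t d : ellQ a b t (- d) = ellQ a b t d.
Proof. by rewrite /ellQ /=; ring. Qed.

Lemma ellipse_mass_gt0 a b t c : 0 < b -> b <= a ->
  0 < mass (ellipse a b t c).
Proof.
move=> b0 ba; have mE := measurable_ellipse a b t c.
apply: (@integral2_gt0 _ _ _ 1 c) => //.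
- by apply: leb2_bounded_lty mE _ => y; exact: ellipse_bounded.
- by apply: ellipse_nbhs; rewrite subrr ellQ_at0.
- exact: cvg_cst.
- by move=> y _; rewrite ler01 lexx.
Qed.

Lemma ellipse_inertia_gt0 a b t : 0 < b -> b <= a ->
  0 < inertia (ellipse a b t 0).
Proof.
move=> b0 ba.
have nE y : norm2 y ^+ 2 = dot2 y y :> R.
  by rewrite sqr_sqrtr// /dot2 -!expr2 addr_ge0 ?sqr_ge0.
rewrite /inertia (_ : (fun y => _) = (fun y => y.1 ^+ 2 + y.2 ^+ 2)); last first.
  by apply/funext => y; rewrite nE.
have mE := measurable_ellipse a b t 0.
have dotz : dot2 (b / 2, 0) (b / 2, 0) = (b / 2) ^+ 2 :> R.
  by rewrite /dot2 /= mulr0 addr0.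
apply: (@integral2_gt0 _ _ _ (a ^+ 2) (b / 2, 0)) => //.
- by apply: leb2_bounded_lty mE _ => y; exact: ellipse_bounded.
- apply: ellipse_nbhs; rewrite subr0.
  have /andP[_ /le_lt_trans] := ellQ_bounds a b t (b / 2, 0) b0 ba; apply.
  by rewrite dotz ltr_pdivrMr ?exprn_gt0//; nra.
- by apply: measurable_funD; apply: measurable_funX.
- by apply: cvgD; apply: cvgM; by [exact: cvg_fst|exact: cvg_snd].
- move=> y; rewrite /ellipse/= addr_ge0 ?sqr_ge0//= subr0.
  by move=> /(ellipse_dot2_le _ _ _ _ b0 ba).
- by rewrite /= expr0n addr0 exprn_gt0// divr_gt0.
Qed.

Lemma ellipse_centre_of_mass a b t c : 0 < b -> b <= a ->
  centre_of_mass (ellipse a b t c) = c.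
Proof.
move=> b0 ba; apply: (@centre_of_mass_reflect _ _ _ (a + `|c|)).
- exact: measurable_ellipse.
- by move=> y; exact: ellipse_bounded.
- by rewrite gt_eqF// ellipse_mass_gt0.
have refl z : ellQ a b t (point_reflect c z - c) = ellQ a b t (z - c).
  rewrite (_ : point_reflect c z - c = - (z - c)) ?ellQN//.
  by rewrite [LHS]surjective_pairing [RHS]surjective_pairing /=; congr pair; ring.
by rewrite /ellipse; apply/seteqP; split => z /=; rewrite refl.
Qed.

End Ellipse.

(** * Grazing collisions *)

Section Grazing.
Context {R : realType}.
Implicit Types (P : set (R * R)) (X : @config R).

(** The reflection in [S] moves [M V] by a multiple of its component along
    [M^-1 nu], and that component is a multiple of [nu . V] since [M] is
    symmetric. Positive mass and inertia make [M] invertible. *)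
Lemma scattering_grazing P X (V : 'cV[R]_6) :
  0 < mass P -> 0 < inertia P -> (nu P X)^T *m V = 0 -> Sigma0 P X V.
Proof.
move=> m0 J0 nuV; rewrite /Sigma0/= /scattering.
have MU : mass_matrix P \in unitmx.
  rewrite /mass_matrix unitmxE det_diag unitfE; apply/prodf_neq0 => i _.
  rewrite !mxE.
  by case: i => [[|[|[|[|[|[|i]]]]]] /= ?] //; rewrite gt_eqF// sqrtr_gt0.
have MT : (mass_matrix P)^T = mass_matrix P by rewrite tr_diag_mx.
rewrite -!mulmxA mulmxBl mul1mx mulmxBr mulKmx// -scalemxAl -!mulmxA.
rewrite /nuhat [(_ *: _)^T]linearZ/= trmx_mul trmx_inv MT.
by rewrite -!scalemxAl -(mulmxA _ (invmx _)) mulKmx// nuV !(mulmx0, scaler0) subr0.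
Qed.

(** [nu . V] is the component along the normal of the relative velocity of the
    two material points in contact. When these velocities agree it vanishes,
    whatever the normal is. *)
Lemma nu_contact_velocity P X (v vbar : R * R) (om ombar : R) :
  v + om *: perp (contact P X - pos X) =
    vbar + ombar *: perp (contact P X - posbar X) ->
  (nu P X)^T *m vec6 v vbar om ombar = 0.
Proof.
rewrite /nu; set p := perp _; set q := perp _; set n := normal P X.
move=> [] e1 e2; apply/matrixP => i j; rewrite !mxE.
rewrite !big_ord_recl big_ord0 !mxE/= /dot2.
have -> : v.1 = vbar.1 + ombar * q.1 - om * p.1.
  by rewrite -[LHS](addrK (om * p.1)) e1.
have -> : v.2 = vbar.2 + ombar * q.2 - om * p.2.
  by rewrite -[LHS](addrK (om * p.2)) e2.
ring.
Qed.

End Grazing.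

(** * Counter-rotating ellipses *)

Theorem corollary1p2 (R : realType) (P : set (R * R))
    (ellP : is_ellipse P) (ndiskP : ~ is_disk P)
    (comP : centre_of_mass P = 0) :
  exists (x0 xbar0 : R * R) (th0 thbar0 : R),
    collision_configs P (Config x0 xbar0 th0 thbar0) /\
    exists (v0 vbar0 : R * R) (om0 ombar0 : R),
      Sigma0 P (Config x0 xbar0 th0 thbar0) (vec6 v0 vbar0 om0 ombar0) /\
      exists delta : R, 0 < delta /\
        forall t : R, - delta < t < 0 \/ 0 < t < delta ->
          (0 < leb2 (placed (th0 + t * om0)%R (x0 + t *: v0)%R P `&`
                     placed (thbar0 + t * ombar0)%R (xbar0 + t *: vbar0)%R P))%E.
Proof.
have [c [s [a [b [b0 ba PE]]]]] := noncircular_ellipseP _ ellP ndiskP.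
have c0 : c = 0 by rewrite -comP PE ellipse_centre_of_mass// ltW.
rewrite {c}c0 in PE.
have a0 : 0 < a by exact: lt_trans ba.
have placedP t x : placed (- s + t) x P = ellipse a b t x.
  by rewrite PE placed_ellipse addrA subrr add0r.
pose e : R * R := (0, b).
(* The angle - s turns the long axis horizontal, so that the bodies meet at the
   origin, each at an end of its short axis. *)
exists (- e), e, (- s), (- s).
set X := Config _ _ _ _.
have bodiesI : body P X `&` bodybar P X = [set 0].
  rewrite /body /bodybar /= -[- s]addr0 !placedP.
  rewrite /ellipse; apply/seteqP; split => [z [] /=|_ -> /=]; rewrite !ellQ0.
    (* With u := z.1 / a and v := z.2 / b, adding the two inequalities
       u ^ 2 + (v + 1) ^ 2 <= 1 and u ^ 2 + (v - 1) ^ 2 <= 1 leaves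
       u ^ 2 + v ^ 2 <= 0. *)
    rewrite opprK /= addr0 subr0 mulrDl mulrBl divff ?gt_eqF//.
    set u := _ / a; set v := _ / b => h1 h2.
    have [u0 v0] : u ^+ 2 = 0 /\ v ^+ 2 = 0 by split; nra.
    move/eqP : u0; move/eqP: v0; rewrite !sqrf_eq0 !mulf_eq0 !invr_eq0.
    rewrite (gt_eqF a0) (gt_eqF b0) !orbF => /eqP z2 /eqP z1.
    by rewrite (surjective_pairing z) z1 z2.
  rewrite opprK add0r sub0r /= oppr0 mulNr mul0r divff ?gt_eqF//.
  by rewrite sqrrN expr0n expr1n add0r.
have contactX : contact P X = 0.
  by rewrite /contact bodiesI; exact: xget_unique.
split.
  by rewrite /collision_configs /= bodiesI leb2_set1; split=> //; exists 0.
(* Both centres are at rest; the spins 1 and - 1 give the two bodies the same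
   velocity (- b, 0) at the contact point. *)
exists 0, 0, 1, (- 1); split.
  apply: scattering_grazing.
  - by rewrite PE ellipse_mass_gt0// ltW.
  - by rewrite PE ellipse_inertia_gt0// ltW.
  apply: nu_contact_velocity; rewrite contactX /= !add0r opprK.
  by rewrite scale1r scaleN1r /perp /e /= -[RHS]/(- - - b, - - 0) !opprK.
(* Any delta up to pi would do: only sin t != 0 is used. *)
exists 1; split => // t ht.
have pi2 := @pi_ge2 R.
have sint : 0 < sin t ^+ 2.
  rewrite exprn_even_gt0//=; case: ht => /andP[t1 t2].
    by rewrite -oppr_eq0 -sinN gt_eqF// sin_gt0_pi//; lra.
  by rewrite gt_eqF// sin_gt0_pi//; lra.
(* The radius of the body towards the origin is b at t = 0 and longer for the
   turned ellipse, while the centres stay at distance b. *)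
have inside (u : R) (y : R * R) : sin u ^+ 2 = sin t ^+ 2 -> y = e \/ y = - e ->
    ellQ a b u y < 1.
  move=> su yE.
  have -> : ellQ a b u y = 1 - sin t ^+ 2 * (1 - (b / a) ^+ 2).
    have cu : cos u ^+ 2 = 1 - sin t ^+ 2 by rewrite -(cos2Dsin2 u) su addrK.
    transitivity (sin u ^+ 2 * (b / a) ^+ 2 + cos u ^+ 2).
      by case: yE => ->; rewrite /ellQ /e /=; field; rewrite !gt_eqF.
    by rewrite cu su; ring.
  rewrite ltrBlDr ltrDl mulr_gt0// subr_gt0 exprn_ilt1 ?divr_ge0 ?ltW//.
  by rewrite ltr_pdivrMr// mul1r.
rewrite !scaler0 !addr0 !placedP.
apply: (@leb2_nbhs_gt0 _ _ 0).
  by apply: measurableI; exact: measurable_ellipse.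
apply: filterI; apply: ellipse_nbhs; apply: inside; rewrite ?sub0r ?opprK; auto.
- by rewrite mulr1.
- by rewrite mulrN1 sinN sqrrN.
Qed.
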